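(* Let $H$ be a cocommutative Hopf algebra over a field $k$ and let $A$ be a commutative unital $k$-algebra with a partial action of $H$. For any $n\ge 0$ and any $f\in C^n_{par}(H,A)$, $$\delta_{n+1}\circ\delta_n(f)=e_{n+2}.$$
   Context: $k$ is a field; Sweedler notation is used and $\epsilon$ is the counit of $H$. A partial action of $H$ on a unital algebra $A$ is a linear map $\cdot:H\otimes A\to A$ such that for all $a,b\in A$, $h,l\in H$: (PA1) $1_H\cdot a=a$; (PA2) $h\cdot(ab)=(h_{(1)}\cdot a)(h_{(2)}\cdot b)$; (PA3) $h\cdot(l\cdot a)=(h_{(1)}\cdot 1_A)(h_{(2)}l\cdot a)$. For $n\ge 0$, $\mathrm{Hom}_k(H^{\otimes n},A)$ is the convolution algebra with product $(f*g)(h^1,\ldots,h^n)=f(h^1_{(1)},\ldots,h^n_{(1)})\,g(h^1_{(2)},\ldots,h^n_{(2)})$ (where $f(h^1,\ldots,h^n)$ means $f(h^1\otimes\cdots\otimes h^n)$) and unit $\epsilon(h^1)\cdots\epsilon(h^n)1_A$; it is commutative. For $n=0$ it is identified with $A$. For $1\le l\le n$ put $\widetilde e_{l,n}(h^1,\ldots,h^n)=((h^1\cdots h^l)\cdot 1_A)\,\epsilon(h^{l+1})\cdots\epsilon(h^n)$ and $e_n=\widetilde e_{1,n}*\widetilde e_{2,n}*\cdots*\widetilde e_{n,n}$ (an idempotent); $e_0=1_A$. For $n\ge 1$ let $I(H^{\otimes n},A)=e_n*\mathrm{Hom}_k(H^{\otimes n},A)$, a unital algebra with unit $e_n$, and let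 $C^n_{par}(H,A)=(I(H^{\otimes n},A))^{\times}$ be its group of invertible elements; $C^0_{par}(H,A)=A^\times$. The inverse of $f$ in $C^n_{par}(H,A)$ is denoted $f^{-1}$. For $n\ge 1$ and $f\in C^n_{par}(H,A)$ the coboundary $\delta_n:C^n_{par}(H,A)\to C^{n+1}_{par}(H,A)$ is $$(\delta_nf)(h^1,\ldots,h^{n+1})=\big(h^1_{(1)}\cdot f(h^2_{(1)},\ldots,h^{n+1}_{(1)})\big)\prod_{i=1}^n f^{(-1)^i}(h^1_{(i+1)},\ldots,h^i_{(i+1)}h^{i+1}_{(i+1)},\ldots,h^{n+1}_{(i+1)})\; f^{(-1)^{n+1}}(h^1_{(n+2)},\ldots,h^n_{(n+2)})$$ (with the last tensorand $h^{n+1}$ in the final factor absorbed by $\epsilon$), and $(\delta_0a)(h)=(h\cdot a)a^{-1}$ for $a\in A^\times$. *)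

(* Defs.v *)
From HB Require Import structures.
From mathcomp Require Import all_boot all_order all_algebra boolp.

Set Implicit Arguments.
Unset Strict Implicit.
Unset Printing Implicit Defensive.

Import GRing.Theory.
Local Open Scope ring_scope.
Local Open Scope quotient_scope.

Reserved Notation "v ⊗ w" (at level 40, left associativity).
Reserved Notation "a ∙ b" (at level 40, left associativity).

Section LinearMaps.
Context {k : fieldType} {U V : lmodType k}.

Definition mklin (f : U -> V) (Hf : linear f) : {linear U -> V} :=
  HB.pack f (GRing.isLinear.Build k U V *:%R f Hf).

Lemma mklinE f Hf x : @mklin f Hf x = f x. Proof. by []. Qed.

Lemma linear_ext (f g : {linear U -> V}) : f =1 g -> f = g.
Proof.
case: f g => f [[cf] [sf]] [g [[cg] [sg]]] /= /funext fg; subst g.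
by rewrite (Prop_irrelevance cf cg) (Prop_irrelevance sf sg).
Qed.
End LinearMaps.

(* Formal sums of pairs modulo the congruence generated by the tensor relations *)
Section Tensor.
Context {k : fieldType} (V W : lmodType k).

Inductive tensor_cong : seq (V * W) -> seq (V * W) -> Prop :=
| tensor_refl s : tensor_cong s s
| tensor_sym s t : tensor_cong s t -> tensor_cong t s
| tensor_trans s t u : tensor_cong s t -> tensor_cong t u -> tensor_cong s u
| tensor_cat s s' t t' :
    tensor_cong s s' -> tensor_cong t t' -> tensor_cong (s ++ t) (s' ++ t')
| tensor_catC s t : tensor_cong (s ++ t) (t ++ s)
| tensor_0 w : tensor_cong [:: (0, w)] [::]
| tensor_Dl v v' w : tensor_cong [:: (v + v', w)] [:: (v, w); (v', w)]
| tensor_Dr v w w' : tensor_cong [:: (v, w + w')] [:: (v, w); (v, w')]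
| tensor_Z (c : k) v w : tensor_cong [:: (c *: v, w)] [:: (v, c *: w)].

Definition tensor_rel : rel (seq (V * W)) := fun s t => `[< tensor_cong s t >].

Lemma tensor_rel_equiv : equiv_class_of tensor_rel.
Proof.
split=> [s|s t|t s u].
- exact/asboolP/tensor_refl.
- by apply/asboolP/asboolP => /tensor_sym.
- by move=> /asboolP st /asboolP tu; apply/asboolP/(tensor_trans st tu).
Qed.

Canonical tensor_equiv := EquivRelPack tensor_rel_equiv.

Definition tensor : Type := {eq_quot tensor_rel}.
HB.instance Definition _ := Choice.on tensor.
HB.instance Definition _ := Quotient.on tensor.
HB.instance Definition _ := EqQuotient.on tensor.

Lemma tensor_piP s t : \pi_tensor s = \pi_tensor t <-> tensor_cong s t.
Proof.
split; first by move=> /eqmodP /asboolP.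
by move=> st; apply/eqmodP/asboolP.
Qed.

Lemma tensor_repr s : tensor_cong (repr (\pi_tensor s)) s.
Proof. by apply/tensor_piP; rewrite reprK. Qed.

Definition tensor_zero : tensor := \pi_tensor [::].
Definition tensor_add (s t : tensor) : tensor := \pi_tensor (repr s ++ repr t).
Definition tensor_scale (c : k) (t : tensor) : tensor :=
  \pi_tensor [seq (c *: p.1, p.2) | p <- repr t].
Definition tensor_opp (t : tensor) : tensor := tensor_scale (-1) t.

Lemma tensor_cong_scale c s t : tensor_cong s t ->
  tensor_cong [seq (c *: p.1, p.2) | p <- s] [seq (c *: p.1, p.2) | p <- t].
Proof.
elim=> {s t} /= [s|s t _|s t u _ st _|s s' t t' _ ss _ tt|s t|w|v v' w|v w w'|d v w].
- exact: tensor_refl.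
- exact: tensor_sym.
- exact: tensor_trans.
- by rewrite !map_cat; exact: tensor_cat.
- by rewrite !map_cat; exact: tensor_catC.
- by rewrite scaler0; exact: tensor_0.
- by rewrite scalerDr; exact: tensor_Dl.
- exact: tensor_Dr.
- by rewrite scalerA mulrC -scalerA; exact: tensor_Z.
Qed.

Lemma tensor_add_pi s t :
  tensor_add (\pi_tensor s) (\pi_tensor t) = \pi_tensor (s ++ t).
Proof. by apply/tensor_piP/tensor_cat; exact: tensor_repr. Qed.

Lemma tensor_scale_pi c s :
  tensor_scale c (\pi_tensor s) = \pi_tensor [seq (c *: p.1, p.2) | p <- s].
Proof. by apply/tensor_piP/tensor_cong_scale/tensor_repr. Qed.

Lemma tensor_addA : associative tensor_add.
Proof.
move=> s t u; rewrite -[s]reprK -[t]reprK -[u]reprK.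
rewrite (tensor_add_pi (repr t)) (tensor_add_pi (repr s) (repr t)).
by rewrite (tensor_add_pi (repr s)) tensor_add_pi catA.
Qed.

Lemma tensor_addC : commutative tensor_add.
Proof. by move=> s t; apply/tensor_piP/tensor_catC. Qed.

Lemma tensor_add0 : left_id tensor_zero tensor_add.
Proof. by move=> s; rewrite -[s]reprK tensor_add_pi. Qed.

Lemma tensor_scale0 t : tensor_scale 0 t = tensor_zero.
Proof.
rewrite -[t]reprK tensor_scale_pi; apply/tensor_piP.
elim: (repr t) => [|p s IHs] /=; first exact: tensor_refl.
rewrite scale0r -cat1s -[X in tensor_cong _ X]cat0s.
by apply: tensor_cat => //; exact: tensor_0.
Qed.

Lemma tensor_scaleDl t : {morph tensor_scale^~ t : a b / a + b >-> tensor_add a b}.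
Proof.
move=> a b; rewrite -[t]reprK !tensor_scale_pi tensor_add_pi; apply/tensor_piP.
elim: (repr t) => [|p s IHs] /=; first exact: tensor_refl.
rewrite scalerDl -cat1s.
apply: tensor_trans (tensor_cat (tensor_Dl _ _ _) IHs) _.
set x := (a *: _, _); set y := (b *: _, _).
set sa := [seq _ | p <- s]; set sb := [seq _ | p <- s].
apply: (@tensor_cat [:: x] [:: x] ([:: y] ++ sa ++ sb) (sa ++ y :: sb)).
  exact: tensor_refl.
rewrite -[y :: sb]cat1s !catA; apply: tensor_cat; last exact: tensor_refl.
exact: tensor_catC.
Qed.

Lemma tensor_scaleDr : right_distributive tensor_scale tensor_add.
Proof.
move=> c s t; rewrite -[s]reprK -[t]reprK.
rewrite (tensor_add_pi (repr s)) !(tensor_scale_pi _ (repr _)).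
by rewrite tensor_scale_pi tensor_add_pi map_cat.
Qed.

Lemma tensor_scale1 : left_id 1 tensor_scale.
Proof.
move=> t; rewrite -[t]reprK tensor_scale_pi; congr (\pi_tensor _).
by rewrite -[RHS]map_id; apply: eq_map => -[v w] /=; rewrite scale1r.
Qed.

Lemma tensor_scaleA a b t : tensor_scale a (tensor_scale b t) = tensor_scale (a * b) t.
Proof.
rewrite -[t]reprK (tensor_scale_pi b) !tensor_scale_pi; congr (\pi_tensor _).
by rewrite -map_comp; apply: eq_map => -[v w] /=; rewrite scalerA.
Qed.

Lemma tensor_addN : left_inverse tensor_zero tensor_opp tensor_add.
Proof.
by move=> t; rewrite -{2}[t]tensor_scale1 -tensor_scaleDl addNr tensor_scale0.
Qed.

HB.instance Definition _ := GRing.isZmodule.Build tensor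
  tensor_addA tensor_addC tensor_add0 tensor_addN.
HB.instance Definition _ := GRing.Zmodule_isLmodule.Build k tensor
  tensor_scaleA tensor_scale1 tensor_scaleDr tensor_scaleDl.

Definition pure (v : V) (w : W) : tensor := \pi_tensor [:: (v, w)].

Lemma tensor_piE s : \pi_tensor s = \sum_(p <- s) pure p.1 p.2.
Proof.
elim: s => [|[v w] s IHs]; first by rewrite big_nil.
by rewrite big_cons -IHs /= -[RHS]/(tensor_add _ _) tensor_add_pi.
Qed.

Lemma tensor_sumE (t : tensor) : t = \sum_(p <- repr t) pure p.1 p.2.
Proof. by rewrite -tensor_piE reprK. Qed.

End Tensor.

Notation "v ⊗ w" := (pure v w) : ring_scope.

Section TensorTheory.
Context {k : fieldType}.
Implicit Types U V W X : lmodType k.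

Lemma pureDl V W (v v' : V) (w : W) : (v + v') ⊗ w = v ⊗ w + v' ⊗ w.
Proof.
by rewrite -[RHS]/(tensor_add _ _) tensor_add_pi; apply/tensor_piP/tensor_Dl.
Qed.

Lemma pureDr V W (v : V) (w w' : W) : v ⊗ (w + w') = v ⊗ w + v ⊗ w'.
Proof.
by rewrite -[RHS]/(tensor_add _ _) tensor_add_pi; apply/tensor_piP/tensor_Dr.
Qed.

Lemma pureZl V W (c : k) (v : V) (w : W) : (c *: v) ⊗ w = c *: (v ⊗ w).
Proof. by rewrite -[RHS]/(tensor_scale _ _) tensor_scale_pi. Qed.

Lemma pureZr V W (c : k) (v : V) (w : W) : v ⊗ (c *: w) = c *: (v ⊗ w).
Proof. by rewrite -pureZl; apply/esym/tensor_piP/tensor_Z. Qed.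

Definition pureE := (@pureDl, @pureDr, @pureZl, @pureZr).

Definition bilin V W U (B : V -> W -> U) :=
  (forall w, linear (B^~ w)) /\ (forall v, linear (B v)).

Definition trilin V W X U (T : V -> W -> X -> U) :=
  [/\ forall w x, linear (fun v => T v w x), forall v x, linear (fun w => T v w x)
    & forall v w, linear (T v w)].

Lemma linear_sumr V W I (r : seq I) (f : I -> V -> W) :
  (forall i, linear (f i)) -> linear (fun x => \sum_(i <- r) f i x).
Proof.
move=> Hf c u v; rewrite scaler_sumr -big_split /=.
by apply: eq_bigr => i _; rewrite Hf.
Qed.

Lemma linear0' V W (f : V -> W) : linear f -> f 0 = 0.
Proof. by move=> Hf; rewrite -(mklinE Hf) linear0. Qed.

Lemma linear_sum' V W (f : V -> W) I (r : seq I) F : linear f ->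
  f (\sum_(i <- r) F i) = \sum_(i <- r) f (F i).
Proof. by move=> Hf; rewrite -(mklinE Hf) linear_sum. Qed.

Lemma bilin_pure V W : bilin (@pure k V W).
Proof. by split=> [w|v] c x y; rewrite !pureE. Qed.

(* [v ⊗ w |-> B v w]; meaningful only for bilinear [B] *)
Definition tlift V W U (B : V -> W -> U) (t : tensor V W) : U :=
  \sum_(p <- repr t) B p.1 p.2.

Lemma tlift_cong V W U (B : V -> W -> U) s t : bilin B -> tensor_cong s t ->
  \sum_(p <- s) B p.1 p.2 = \sum_(p <- t) B p.1 p.2.
Proof.
move=> [Bl Br].
elim=> {s t} /= [s|s t _ ->|s t u _ -> _ ->|s s' t t' _ ss _ tt|s t|w|v v' w|v w w'|d v w] //.
- by rewrite !big_cat /= ss tt.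
- by rewrite !big_cat /= addrC.
- by rewrite big_seq1 big_nil /= (linear0' (Bl w)).
- by rewrite big_seq1 !big_cons big_nil /= addr0 -(mklinE (Bl w)) linearD.
- by rewrite big_seq1 !big_cons big_nil /= addr0 -!(mklinE (Br v)) linearD.
- by rewrite !big_seq1 /= -(mklinE (Bl w)) -(mklinE (Br v)) !linearZ.
Qed.

Lemma tlift_pi V W U (B : V -> W -> U) s : bilin B ->
  tlift B (\pi_(tensor V W) s) = \sum_(p <- s) B p.1 p.2.
Proof. by move=> HB; apply: tlift_cong HB _; exact: tensor_repr. Qed.

Lemma tliftE V W U (B : V -> W -> U) v w : bilin B -> tlift B (v ⊗ w) = B v w.
Proof. by move=> HB; rewrite tlift_pi // big_seq1. Qed.

Lemma tlift_linear V W U (B : V -> W -> U) : bilin B -> linear (tlift B).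
Proof.
move=> HB c s t.
have -> : c *: s + t =
    \pi_(tensor V W) ([seq (c *: p.1, p.2) | p <- repr s] ++ repr t).
  by rewrite -tensor_add_pi reprK.
rewrite tlift_pi // big_cat big_map /=; congr (_ + _).
rewrite scaler_sumr; apply: eq_bigr => p _.
by case: HB => Bl _; rewrite -(mklinE (Bl p.2)) linearZ.
Qed.

Definition tlin V W U (B : V -> W -> U) (HB : bilin B) : {linear tensor V W -> U} :=
  mklin (tlift_linear HB).

Lemma tlinE V W U (B : V -> W -> U) (HB : bilin B) v w : tlin HB (v ⊗ w) = B v w.
Proof. exact: tliftE. Qed.

Lemma tensor_ext V W U (f g : tensor V W -> U) : linear f -> linear g ->
  (forall v w, f (v ⊗ w) = g (v ⊗ w)) -> f =1 g.
Proof.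
move=> Hf Hg fg t; rewrite [t]tensor_sumE !(linear_sum' _ _ Hf, linear_sum' _ _ Hg).
by apply: eq_bigr => p _.
Qed.

Lemma tmap_bilin V W V' W' (f : {linear V -> V'}) (g : {linear W -> W'}) :
  bilin (fun v w => f v ⊗ g w).
Proof. by split=> [w|v] c x y; rewrite linearP !pureE. Qed.

Definition tmap V W V' W' (f : {linear V -> V'}) (g : {linear W -> W'}) :
    {linear tensor V W -> tensor V' W'} :=
  tlin (tmap_bilin f g).

End TensorTheory.

HB.mixin Record Lmodule_isCoalgebra (k : fieldType) C of GRing.Lmodule k C := {
  comul : {linear C -> tensor C C};
  counit : {scalar C};
  coassoc_subproof : forall x : C,
    \sum_(p <- repr (comul x)) \sum_(q <- repr (comul p.1)) q.1 ⊗ (q.2 ⊗ p.2) =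
    \sum_(p <- repr (comul x)) \sum_(q <- repr (comul p.2)) p.1 ⊗ (q.1 ⊗ q.2);
  counitl_subproof : forall x : C, \sum_(p <- repr (comul x)) counit p.1 *: p.2 = x;
  counitr_subproof : forall x : C, \sum_(p <- repr (comul x)) counit p.2 *: p.1 = x
}.

#[short(type="coalgType")]
HB.structure Definition Coalgebra (k : fieldType) :=
  {C of GRing.Lmodule k C & Lmodule_isCoalgebra k C}.

(* Sweedler notation: a list of pairs (x_(1), x_(2)) with sum of x_(1) ⊗ x_(2)
   equal to [comul x]. The choice of the list is irrelevant in every expression
   that is bilinear in the two components. *)
Definition sw (k : fieldType) (C : coalgType k) (x : C) : seq (C * C) :=
  repr (comul x).

HB.mixin Record Coalgebra_isCocommutative (k : fieldType) C of Coalgebra k C := {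
  comulC_subproof : forall x : C, \sum_(p <- sw x) p.2 ⊗ p.1 = comul x
}.

#[short(type="cocomCoalgType")]
HB.structure Definition CocomCoalgebra (k : fieldType) :=
  {C of Coalgebra k C & Coalgebra_isCocommutative k C}.

HB.mixin Record Algebra_Coalgebra_isHopf (k : fieldType) H
    of GRing.Algebra k H & Coalgebra k H := {
  comulM : forall x y : H, comul (x * y) =
    \sum_(p <- sw x) \sum_(q <- sw y) (p.1 * q.1) ⊗ (p.2 * q.2);
  comul1 : comul (1 : H) = 1 ⊗ 1;
  counitM : forall x y : H, counit (x * y) = counit x * counit y;
  counit1 : counit (1 : H) = 1;
  antipode : {linear H -> H};
  antipodel : forall x : H, \sum_(p <- sw x) antipode p.1 * p.2 = (counit x)%:A;
  antipoder : forall x : H, \sum_(p <- sw x) p.1 * antipode p.2 = (counit x)%:A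
}.

#[short(type="hopfAlgType")]
HB.structure Definition HopfAlgebra (k : fieldType) :=
  {H of GRing.Algebra k H & Coalgebra k H & Algebra_Coalgebra_isHopf k H}.

#[short(type="cocomHopfAlgType")]
HB.structure Definition CocomHopfAlgebra (k : fieldType) :=
  {H of HopfAlgebra k H & Coalgebra_isCocommutative k H}.

(* Commutative unital k-algebras. MathComp's [comAlgType k] requires 1 != 0; here
   the zero algebra is allowed. *)
HB.mixin Record Lmodule_isComUnitalAlgebra (k : fieldType) A of GRing.Lmodule k A := {
  aone : A;
  amul : A -> A -> A;
  amulA : associative amul;
  amulC : commutative amul;
  amul1 : left_id aone amul;
  amulDl : left_distributive amul +%R;
  amulZl : forall (c : k) (a b : A), amul (c *: a) b = c *: amul a b
}.

#[short(type="comUnitalAlgType")]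
HB.structure Definition ComUnitalAlgebra (k : fieldType) :=
  {A of GRing.Lmodule k A & Lmodule_isComUnitalAlgebra k A}.

Arguments aone {k A} : rename.
Notation "a ∙ b" := (amul a b) : ring_scope.

Definition of_comAlg (k : fieldType) (A : comAlgType k) : Type := A.
HB.instance Definition _ (k : fieldType) (A : comAlgType k) :=
  GRing.Lmodule.on (@of_comAlg k A).
HB.instance Definition _ (k : fieldType) (A : comAlgType k) :=
  Lmodule_isComUnitalAlgebra.Build k (@of_comAlg k A)
    (@mulrA A) (@mulrC A) (@mul1r A) (@mulrDl A) (fun c a b => esym (scalerAl c a b)).


Section CoalgebraTheory.
Context {k : fieldType}.
Implicit Types (C D : coalgType k) (U V : lmodType k).

Lemma swE C U (B : C -> C -> U) x : \sum_(p <- sw x) B p.1 p.2 = tlift B (comul x).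
Proof. by []. Qed.

Lemma sw_pure C (x : C) : \sum_(p <- sw x) p.1 ⊗ p.2 = comul x.
Proof. by rewrite [RHS]tensor_sumE. Qed.

Lemma sw_linear C U (B : C -> C -> U) : bilin B ->
  linear (fun x => \sum_(p <- sw x) B p.1 p.2).
Proof. by move=> HB c x y; rewrite !swE linearP tlift_linear. Qed.

Lemma counitl C (x : C) : \sum_(p <- sw x) counit p.1 *: p.2 = x.
Proof. exact: counitl_subproof. Qed.

Lemma counitr C (x : C) : \sum_(p <- sw x) counit p.2 *: p.1 = x.
Proof. exact: counitr_subproof. Qed.

Lemma coassoc C U (T : C -> C -> C -> U) (x : C) : trilin T ->
  \sum_(p <- sw x) \sum_(q <- sw p.1) T q.1 q.2 p.2 =
  \sum_(p <- sw x) \sum_(q <- sw p.2) T p.1 q.1 q.2.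
Proof.
move=> [T1 T2 T3].
have HB a : bilin (T a) by split=> [w|v]; [exact: T2|exact: T3].
have HB2 : bilin (fun a (t : tensor C C) => tlift (T a) t).
  split=> [t|a]; last exact/tlift_linear/HB.
  by apply: linear_sumr => p; exact: T1.
have /(congr1 (tlin HB2)) := @coassoc_subproof k C x.
rewrite !linear_sum; under eq_bigr do rewrite linear_sum.
under [RHS]eq_bigr do rewrite linear_sum.
under eq_bigr do under eq_bigr do rewrite tlinE (tliftE _ _ (HB _)).
by under [RHS]eq_bigr do under eq_bigr do rewrite tlinE (tliftE _ _ (HB _)).
Qed.

Lemma comulC (C : cocomCoalgType k) U (B : C -> C -> U) (x : C) : bilin B ->
  \sum_(p <- sw x) B p.2 p.1 = \sum_(p <- sw x) B p.1 p.2.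
Proof.
move=> HB; rewrite [RHS]swE -comulC_subproof (linear_sum' _ _ (tlift_linear HB)).
by apply: eq_bigr => p _; rewrite tliftE.
Qed.

Section TensorCoalgebra.
Variables C D : coalgType k.

Definition tensor_comul_fun (v : C) (w : D) : tensor (tensor C D) (tensor C D) :=
  \sum_(p <- sw v) \sum_(q <- sw w) (p.1 ⊗ q.1) ⊗ (p.2 ⊗ q.2).

Lemma tensor_comul_bilin : bilin tensor_comul_fun.
Proof.
split=> [w|v].
  apply: (@sw_linear _ _ (fun a b => \sum_(q <- sw w) (a ⊗ q.1) ⊗ (b ⊗ q.2))).
  by split=> c; apply: linear_sumr => q d x y; rewrite !pureE.
apply: linear_sumr => p.
apply: (@sw_linear _ _ (fun a b => (p.1 ⊗ a) ⊗ (p.2 ⊗ b))).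
by split=> c d x y; rewrite !pureE.
Qed.

Lemma tensor_counit_bilin :
  bilin (fun (v : C) (w : D) => counit v * counit w : k^o).
Proof.
split=> [w|v] c x y; rewrite linearP /=; first by rewrite mulrDl -mulrA.
by rewrite mulrDr mulrCA.
Qed.

Definition tensor_comul : {linear tensor C D -> tensor (tensor C D) (tensor C D)} :=
  tlin tensor_comul_bilin.

Definition tensor_counit : {scalar (tensor C D)} :=
  HB.pack (tlift (fun (v : C) (w : D) => counit v * counit w : k^o))
    (GRing.isLinear.Build k (tensor C D) k *%R _ (tlift_linear tensor_counit_bilin)).

Lemma tensor_counitE v w : tensor_counit (v ⊗ w) = counit v * counit w.
Proof. by rewrite /tensor_counit /= (tliftE _ _ tensor_counit_bilin). Qed.

Lemma tensor_comul_sum U (B : tensor C D -> tensor C D -> U) v w : bilin B ->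
  \sum_(p <- repr (tensor_comul (v ⊗ w))) B p.1 p.2 =
  \sum_(p <- sw v) \sum_(q <- sw w) B (p.1 ⊗ q.1) (p.2 ⊗ q.2).
Proof.
move=> HB; rewrite -[LHS]/(tlift B _) tlinE (linear_sum' _ _ (tlift_linear HB)).
apply: eq_bigr => p _; rewrite (linear_sum' _ _ (tlift_linear HB)).
by apply: eq_bigr => q _; rewrite tliftE.
Qed.

Lemma tensor_sum_linear U (B : tensor C D -> tensor C D -> U) : bilin B ->
  linear (fun x => \sum_(p <- repr (tensor_comul x)) B p.1 p.2).
Proof.
move=> HB c x y; rewrite -![\sum_(p <- _) _]/(tlift B _).
by rewrite linearP (tlift_linear HB).
Qed.

Lemma tensor_coassoc (x : tensor C D) :
  \sum_(p <- repr (tensor_comul x)) \sum_(q <- repr (tensor_comul p.1))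
     q.1 ⊗ (q.2 ⊗ p.2) =
  \sum_(p <- repr (tensor_comul x)) \sum_(q <- repr (tensor_comul p.2))
     p.1 ⊗ (q.1 ⊗ q.2).
Proof.
pose E := tensor C D.
have HL (b : E) : bilin (fun q1 q2 : E => q1 ⊗ (q2 ⊗ b)).
  by split=> ? ? ? ?; rewrite !pureE.
have HR (a : E) : bilin (fun q1 q2 : E => a ⊗ (q1 ⊗ q2)).
  by split=> ? ? ? ?; rewrite !pureE.
have HBL : bilin (fun a b : E => \sum_(q <- repr (tensor_comul a)) q.1 ⊗ (q.2 ⊗ b)).
  split=> [b|a]; first exact: tensor_sum_linear (HL b).
  by apply: linear_sumr => q ? ? ?; rewrite !pureE.
have HBR : bilin (fun a b : E => \sum_(q <- repr (tensor_comul b)) a ⊗ (q.1 ⊗ q.2)).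
  split=> [b|a]; last exact: tensor_sum_linear (HR a).
  by apply: linear_sumr => q ? ? ?; rewrite !pureE.
move: x; apply: tensor_ext => [||v w].
- exact: tensor_sum_linear HBL.
- exact: tensor_sum_linear HBR.
rewrite (tensor_comul_sum _ _ HBL) (tensor_comul_sum _ _ HBR) /=.
under eq_bigr do under eq_bigr do rewrite (tensor_comul_sum _ _ (HL _)).
under [RHS]eq_bigr do under eq_bigr do rewrite (tensor_comul_sum _ _ (HR _)).
pose T (a b c : C) (a' b' c' : D) : tensor E (tensor E E) :=
  (a ⊗ a') ⊗ ((b ⊗ b') ⊗ (c ⊗ c')).
have TC a' b' c' : trilin (fun a b c => T a b c a' b' c').
  by split=> ? ? ? ? ?; rewrite /T !pureE.
have TD a b c : trilin (T a b c).
  by split=> ? ? ? ? ?; rewrite /T !pureE.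
transitivity (\sum_(p <- sw v) \sum_(p' <- sw p.1) \sum_(q <- sw w)
    \sum_(q' <- sw q.1) T p'.1 p'.2 p.2 q'.1 q'.2 q.2).
  by apply: eq_bigr => p _; rewrite exchange_big.
transitivity (\sum_(p <- sw v) \sum_(p' <- sw p.1) \sum_(q <- sw w)
    \sum_(q' <- sw q.2) T p'.1 p'.2 p.2 q.1 q'.1 q'.2).
  apply: eq_bigr => p _; apply: eq_bigr => p' _.
  exact: (coassoc _ (TD p'.1 p'.2 p.2)).
transitivity (\sum_(p <- sw v) \sum_(p' <- sw p.2) \sum_(q <- sw w)
    \sum_(q' <- sw q.2) T p.1 p'.1 p'.2 q.1 q'.1 q'.2); last first.
  by apply: eq_bigr => p _; rewrite exchange_big.
apply: (@coassoc _ _ (fun a b c => \sum_(q <- sw w) \sum_(q' <- sw q.2)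
    T a b c q.1 q'.1 q'.2)).
split=> a b; apply: linear_sumr => q; apply: linear_sumr => q'.
- by case: (TC q.1 q'.1 q'.2) => H _ _; exact: H.
- by case: (TC q.1 q'.1 q'.2) => _ H _; exact: H.
- by case: (TC q.1 q'.1 q'.2) => _ _ H; exact: H.
Qed.

Lemma scale_bilin_l : bilin (fun a b : tensor C D => tensor_counit a *: b).
Proof.
split=> [b|a] c x y; first by rewrite linearP scalerDl scalerA.
by rewrite scalerDr !scalerA mulrC.
Qed.

Lemma scale_bilin_r : bilin (fun a b : tensor C D => tensor_counit b *: a).
Proof.
split=> [b|a] c x y; last by rewrite linearP scalerDl scalerA.
by rewrite scalerDr !scalerA mulrC.
Qed.

Lemma linear_id V : linear (id : V -> V). Proof. by []. Qed.

Lemma tensor_counitl (x : tensor C D) :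
  \sum_(p <- repr (tensor_comul x)) tensor_counit p.1 *: p.2 = x.
Proof.
move: x; apply: tensor_ext => [||v w]; last 1 first.
- rewrite (tensor_comul_sum _ _ scale_bilin_l).
  rewrite -[in RHS](counitl v) -[in RHS](counitl w).
  rewrite (linear_sum' _ _ ((bilin_pure C D).1 _)); apply: eq_bigr => p _.
  rewrite (linear_sum' _ _ ((bilin_pure C D).2 _)); apply: eq_bigr => q _.
  by rewrite tensor_counitE !pureE scalerA.
- exact: tensor_sum_linear scale_bilin_l.
- exact: linear_id.
Qed.

Lemma tensor_counitr (x : tensor C D) :
  \sum_(p <- repr (tensor_comul x)) tensor_counit p.2 *: p.1 = x.
Proof.
move: x; apply: tensor_ext => [||v w]; last 1 first.
- rewrite (tensor_comul_sum _ _ scale_bilin_r).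
  rewrite -[in RHS](counitr v) -[in RHS](counitr w).
  rewrite (linear_sum' _ _ ((bilin_pure C D).1 _)); apply: eq_bigr => p _.
  rewrite (linear_sum' _ _ ((bilin_pure C D).2 _)); apply: eq_bigr => q _.
  by rewrite tensor_counitE !pureE scalerA.
- exact: tensor_sum_linear scale_bilin_r.
- exact: linear_id.
Qed.

HB.instance Definition _ := Lmodule_isCoalgebra.Build k (tensor C D)
  tensor_coassoc tensor_counitl tensor_counitr.

Lemma sw_tensor U (B : tensor C D -> tensor C D -> U) v w : bilin B ->
  \sum_(p <- sw (v ⊗ w)) B p.1 p.2 =
  \sum_(p <- sw v) \sum_(q <- sw w) B (p.1 ⊗ q.1) (p.2 ⊗ q.2).
Proof. exact: tensor_comul_sum. Qed.

Lemma counit_tensor (v : C) (w : D) : counit (v ⊗ w) = counit v * counit w.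
Proof. exact: tensor_counitE. Qed.

End TensorCoalgebra.

Lemma tensor_comulC (C D : cocomCoalgType k) (x : tensor C D) :
  \sum_(p <- sw x) p.2 ⊗ p.1 = comul x.
Proof.
have HB : bilin (fun a b : tensor C D => b ⊗ a).
  by split=> ? ? ? ?; rewrite !pureE.
rewrite -[RHS]sw_pure; move: x; apply: tensor_ext => [||v w].
- exact: sw_linear HB.
- exact/sw_linear/bilin_pure.
rewrite (sw_tensor _ _ HB) (sw_tensor _ _ (bilin_pure _ _)) /=.
rewrite (@comulC _ _ (fun a b => \sum_(q <- sw w) (a ⊗ q.2) ⊗ (b ⊗ q.1))); last first.
  by split=> ?; apply: linear_sumr => q ? ? ?; rewrite !pureE.
apply: eq_bigr => p _.
rewrite (@comulC _ _ (fun a b => (p.1 ⊗ a) ⊗ (p.2 ⊗ b))) //.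
by split=> ? ? ? ?; rewrite !pureE.
Qed.

HB.instance Definition _ (C D : cocomCoalgType k) :=
  Coalgebra_isCocommutative.Build k (tensor C D) (@tensor_comulC C D).

Lemma ground_comul_linear : linear (fun c : k^o => (c : k) *: ((1 : k^o) ⊗ (1 : k^o))).
Proof. by move=> a x y; rewrite scalerDl scalerA. Qed.

Definition ground_comul : {linear k^o -> tensor k^o k^o} := mklin ground_comul_linear.

Definition ground_counit : {scalar k^o} :=
  HB.pack (fun c : k^o => c : k)
    (GRing.isLinear.Build k k^o k *%R (fun c : k^o => c : k) (fun a x y => erefl)).

Lemma ground_sum U (B : k^o -> k^o -> U) x : bilin B ->
  \sum_(p <- repr (ground_comul x)) B p.1 p.2 = (x : k) *: B 1 1.
Proof.
move=> HB; rewrite -[LHS]/(tlift B _) /ground_comul mklinE.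
by rewrite -(mklinE (tlift_linear HB)) linearZ /= (tliftE _ _ HB).
Qed.

Lemma ground_coassoc (x : k^o) :
  \sum_(p <- repr (ground_comul x)) \sum_(q <- repr (ground_comul p.1))
     q.1 ⊗ (q.2 ⊗ p.2) =
  \sum_(p <- repr (ground_comul x)) \sum_(q <- repr (ground_comul p.2))
     p.1 ⊗ (q.1 ⊗ q.2).
Proof.
transitivity ((x : k) *: ((1 : k^o) ⊗ ((1 : k^o) ⊗ (1 : k^o)))).
  have HB b : bilin (fun q1 q2 : k^o => q1 ⊗ (q2 ⊗ (b : k^o))).
    by split=> ? ? ? ?; rewrite !pureE.
  under eq_bigr do rewrite (ground_sum _ (HB _)).
  rewrite (@ground_sum _ (fun a b => (a : k) *: ((1 : k^o) ⊗ ((1 : k^o) ⊗ b)))) ?scale1r //.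
  split=> [b|a] c u v; first by rewrite scalerDl scalerA.
  by rewrite !pureE scalerDr !scalerA mulrC.
have HB b : bilin (fun q1 q2 : k^o => (b : k^o) ⊗ (q1 ⊗ q2)).
  by split=> ? ? ? ?; rewrite !pureE.
under eq_bigr do rewrite (ground_sum _ (HB _)).
rewrite (@ground_sum _ (fun a b => (b : k) *: (a ⊗ ((1 : k^o) ⊗ (1 : k^o))))) ?scale1r //.
split=> [b|a] c u v; last by rewrite scalerDl scalerA.
by rewrite !pureE scalerDr !scalerA mulrC.
Qed.

Lemma ground_counitl (x : k^o) :
  \sum_(p <- repr (ground_comul x)) ground_counit p.1 *: p.2 = x.
Proof.
rewrite (@ground_sum _ (fun a b : k^o => (a : k) *: b)).
  by rewrite scale1r; exact: mulr1.
split=> [b|a] c u v; first by rewrite scalerDl scalerA.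
by rewrite scalerDr !scalerA mulrC.
Qed.

Lemma ground_counitr (x : k^o) :
  \sum_(p <- repr (ground_comul x)) ground_counit p.2 *: p.1 = x.
Proof.
rewrite (@ground_sum _ (fun a b : k^o => (b : k) *: a)).
  by rewrite scale1r; exact: mulr1.
split=> [b|a] c u v; last by rewrite scalerDl scalerA.
by rewrite scalerDr !scalerA mulrC.
Qed.

HB.instance Definition _ := Lmodule_isCoalgebra.Build k k^o
  ground_coassoc ground_counitl ground_counitr.

Lemma sw_ground U (B : k^o -> k^o -> U) (x : k^o) : bilin B ->
  \sum_(p <- sw x) B p.1 p.2 = (x : k) *: B 1 1.
Proof. exact: ground_sum. Qed.

Lemma ground_comulC (x : k^o) : \sum_(p <- sw x) p.2 ⊗ p.1 = comul x.
Proof.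
rewrite (@sw_ground _ (fun a b => b ⊗ a)) //.
by split=> ? ? ? ?; rewrite !pureE.
Qed.

HB.instance Definition _ := Coalgebra_isCocommutative.Build k k^o ground_comulC.

End CoalgebraTheory.

Section AlgebraTheory.
Context {k : fieldType} {A : comUnitalAlgType k}.

Lemma amul_bilin : bilin (@amul k A).
Proof.
have H (w : A) : linear (amul^~ w) by move=> c x y; rewrite amulDl amulZl.
by split=> // v c x y; rewrite ![v ∙ _]amulC; exact: H.
Qed.

Lemma amuldl (a b c : A) : (a + b) ∙ c = a ∙ c + b ∙ c. Proof. exact: amulDl. Qed.
Lemma amuldr (a b c : A) : c ∙ (a + b) = c ∙ a + c ∙ b.
Proof. by rewrite ![c ∙ _]amulC amulDl. Qed.
Lemma amulzl x (a b : A) : (x *: a) ∙ b = x *: (a ∙ b). Proof. exact: amulZl. Qed.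
Lemma amulzr x (a b : A) : a ∙ (x *: b) = x *: (a ∙ b).
Proof. by rewrite ![a ∙ _]amulC amulZl. Qed.

Lemma amul_suml I (r : seq I) (F : I -> A) b :
  (\sum_(i <- r) F i) ∙ b = \sum_(i <- r) F i ∙ b.
Proof. exact: (linear_sum' _ _ (amul_bilin.1 b)). Qed.
Lemma amul_sumr I (r : seq I) (F : I -> A) b :
  b ∙ (\sum_(i <- r) F i) = \sum_(i <- r) b ∙ F i.
Proof. exact: (linear_sum' _ _ (amul_bilin.2 b)). Qed.

Definition amulE := (amuldl, amuldr, amulzl, amulzr).
End AlgebraTheory.

Section Convolution.
Context {k : fieldType} (C : cocomCoalgType k) (A : comUnitalAlgType k).

Definition conv : Type := {linear C -> A}.
Coercion linear_of_conv (f : conv) : {linear C -> A} := f.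

HB.instance Definition _ := gen_eqMixin conv.
HB.instance Definition _ := gen_choiceMixin conv.

Implicit Types f g h : conv.

Lemma conv_ext f g : f =1 g -> f = g.
Proof. exact: linear_ext. Qed.

Lemma conv_bilin f g : bilin (fun a b : C => f a ∙ g b).
Proof. by split=> ? ? ? ?; rewrite linearP !amulE. Qed.

Lemma conv_one_linear : linear (fun x : C => counit x *: aone : A).
Proof. by move=> c x y; rewrite linearP scalerDl scalerA. Qed.

Definition conv_zero : conv := \0 : {linear C -> A}.
Definition conv_add f g : conv := f \+ g : {linear C -> A}.
Definition conv_opp f : conv := \- f : {linear C -> A}.
Definition conv_one : conv := mklin conv_one_linear.
Definition conv_mul f g : conv := mklin (sw_linear (conv_bilin f g)).

Lemma conv_addA : associative conv_add.
Proof. by move=> f g h; apply: conv_ext => x; rewrite /= addrA. Qed.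
Lemma conv_addC : commutative conv_add.
Proof. by move=> f g; apply: conv_ext => x; rewrite /= addrC. Qed.
Lemma conv_add0 : left_id conv_zero conv_add.
Proof. by move=> f; apply: conv_ext => x; rewrite /= add0r. Qed.
Lemma conv_addN : left_inverse conv_zero conv_opp conv_add.
Proof. by move=> f; apply: conv_ext => x; rewrite /= addNr. Qed.

HB.instance Definition _ :=
  GRing.isZmodule.Build conv conv_addA conv_addC conv_add0 conv_addN.

Lemma conv_mulE f g x : conv_mul f g x = \sum_(p <- sw x) f p.1 ∙ g p.2.
Proof. by []. Qed.

Lemma conv_mulA : associative conv_mul.
Proof.
move=> f g h; apply: conv_ext => x; rewrite !conv_mulE.
under eq_bigr do rewrite conv_mulE amul_sumr.
under [RHS]eq_bigr do rewrite conv_mulE amul_suml.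
rewrite -(@coassoc _ _ _ (fun a b c => f a ∙ (g b ∙ h c))).
  by apply: eq_bigr => p _; apply: eq_bigr => q _; rewrite amulA.
by split=> ? ? ? ? ?; rewrite linearP !amulE.
Qed.

Lemma conv_mulC : commutative conv_mul.
Proof.
move=> f g; apply: conv_ext => x; rewrite !conv_mulE.
rewrite -(comulC _ (conv_bilin f g)).
by apply: eq_bigr => p _; rewrite amulC.
Qed.

Lemma conv_mul1 : left_id conv_one conv_mul.
Proof.
move=> f; apply: conv_ext => x; rewrite conv_mulE -[in RHS](counitl x) linear_sum.
by apply: eq_bigr => p _; rewrite amulZl amul1 linearZ.
Qed.

Lemma conv_mulDl : left_distributive conv_mul conv_add.
Proof.
move=> f g h; apply: conv_ext => x; rewrite [RHS]/= !conv_mulE -big_split.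
by apply: eq_bigr => p _; rewrite /= amulDl.
Qed.

HB.instance Definition _ := GRing.Zmodule_isComPzRing.Build conv
  conv_mulA conv_mulC conv_mul1 conv_mulDl.

Lemma convME f g x : (f * g) x = \sum_(p <- sw x) f p.1 ∙ g p.2.
Proof. by []. Qed.

Lemma conv1E x : (1 : conv) x = counit x *: aone.
Proof. by []. Qed.

End Convolution.

Section Pullback.
Context {k : fieldType} {A : comUnitalAlgType k}.

Definition pull (C D : cocomCoalgType k) (phi : {linear D -> C}) (f : conv C A) :
  conv D A := (f : {linear C -> A}) \o phi : {linear D -> A}.

Definition comorph (C D : coalgType k) (phi : {linear D -> C}) : Prop :=
  (forall x, counit (phi x) = counit x) /\
  (forall x, comul (phi x) = \sum_(p <- sw x) phi p.1 ⊗ phi p.2).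

Lemma comorph_sw (C D : coalgType k) (phi : {linear D -> C}) (U : lmodType k)
    (B : C -> C -> U) x : comorph phi -> bilin B ->
  \sum_(p <- sw (phi x)) B p.1 p.2 = \sum_(p <- sw x) B (phi p.1) (phi p.2).
Proof.
move=> [_ phiM] HB; rewrite swE phiM (linear_sum' _ _ (tlift_linear HB)).
by apply: eq_bigr => p _; rewrite tliftE.
Qed.

Lemma comorph_tensor (C D E : coalgType k) (phi : {linear tensor C D -> E}) :
  (forall v w, counit (phi (v ⊗ w)) = counit v * counit w) ->
  (forall v w, comul (phi (v ⊗ w)) = \sum_(p <- sw v) \sum_(q <- sw w)
     phi (p.1 ⊗ q.1) ⊗ phi (p.2 ⊗ q.2)) ->
  comorph phi.
Proof.
move=> Hc HM; have HB := tmap_bilin phi phi; split.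
  apply: (@tensor_ext _ _ _ k^o) => [c x y|c x y|v w].
  - by rewrite !linearP.
  - by rewrite linearP.
  - by rewrite Hc counit_tensor.
apply: tensor_ext => [c x y||v w].
- by rewrite !linearP.
- exact: (sw_linear HB).
- by rewrite HM (sw_tensor _ _ HB).
Qed.

Lemma pullE (C D : cocomCoalgType k) (phi : {linear D -> C}) (f : conv C A) x :
  pull phi f x = f (phi x).
Proof. by []. Qed.

Lemma pullM (C D : cocomCoalgType k) (phi : {linear D -> C}) (f g : conv C A) :
  comorph phi -> pull phi (f * g) = pull phi f * pull phi g.
Proof.
move=> Hphi; apply: conv_ext => x.
by rewrite pullE !convME (comorph_sw _ Hphi (conv_bilin f g)).
Qed.

Lemma pull1 (C D : cocomCoalgType k) (phi : {linear D -> C}) :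
  comorph phi -> pull phi (1 : conv C A) = 1.
Proof.
by move=> [Hc _]; apply: conv_ext => x; rewrite pullE !conv1E Hc.
Qed.

Lemma pull_prod (C D : cocomCoalgType k) (phi : {linear D -> C}) I (r : seq I)
    (F : I -> conv C A) : comorph phi ->
  pull phi (\prod_(i <- r) F i) = \prod_(i <- r) pull phi (F i).
Proof.
move=> Hphi; elim: r => [|i r IHr]; first by rewrite !big_nil pull1.
by rewrite !big_cons pullM // IHr.
Qed.

Lemma comorph_id (C : coalgType k) : comorph (idfun : {linear C -> C}).
Proof. by split=> x //=; rewrite sw_pure. Qed.

Lemma comorph_tmap (C C' D D' : coalgType k) (f : {linear C -> C'})
    (g : {linear D -> D'}) : comorph f -> comorph g -> comorph (tmap f g).
Proof.
move=> [fc fM] [gc gM]; apply: comorph_tensor => v w.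
  by rewrite tlinE counit_tensor fc gc.
rewrite tlinE -[LHS]sw_pure (sw_tensor _ _ (bilin_pure _ _)).
rewrite (@comorph_sw _ _ _ _ (fun a b => \sum_(q <- sw (g w)) (a ⊗ q.1) ⊗ (b ⊗ q.2))
  _ (conj fc fM)); last by split=> ?; apply: linear_sumr => q ? ? ?; rewrite !pureE.
apply: eq_bigr => p _.
rewrite (@comorph_sw _ _ _ _ (fun a b => (_ ⊗ a) ⊗ (_ ⊗ b)) _ (conj gc gM)); last first.
  by split=> ? ? ? ?; rewrite !pureE.
by apply: eq_bigr => q _; rewrite !tlinE.
Qed.

End Pullback.

Section PartialAction.
Context {k : fieldType} (H : cocomHopfAlgType k) (A : comUnitalAlgType k).

Record partial_action := PartialAction {
  pact :> {linear tensor H A -> A};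
  pact1 : forall a : A, pact (1 ⊗ a) = a;
  pactM : forall (h : H) (a b : A),
    pact (h ⊗ (a ∙ b)) = \sum_(p <- sw h) pact (p.1 ⊗ a) ∙ pact (p.2 ⊗ b);
  pact_act : forall (h l : H) (a : A),
    pact (h ⊗ pact (l ⊗ a)) =
    \sum_(p <- sw h) pact (p.1 ⊗ aone) ∙ pact ((p.2 * l) ⊗ a)
}.

End PartialAction.

Section TensorPower.
Context {k : fieldType} (H : cocomHopfAlgType k).

(* H ⊗ (H ⊗ ... (H ⊗ k)), with n factors H; (h^1, ..., h^n) below stands for
   h^1 ⊗ (h^2 ⊗ ... (h^n ⊗ 1)). *)
Fixpoint tpow (n : nat) : cocomCoalgType k :=
  if n is m.+1 then tensor H (tpow m) else k^o.

Lemma mul2_bilin (U : lmodType k) (h : H) :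
  bilin (fun (l : H) (x : U) => (h * l) ⊗ x).
Proof. by split=> [x|l] c u v; rewrite ?mulrDr -?scalerAr !pureE. Qed.

Lemma mul3_bilin (U : lmodType k) :
  bilin (fun (h : H) (t : tensor H U) => tlin (mul2_bilin U h) t).
Proof.
split=> [t|h]; last exact: linearP.
by apply: linear_sumr => p c u v; rewrite mulrDl -scalerAl !pureE.
Qed.

(* h ⊗ (l ⊗ x) |-> h l ⊗ x *)
Definition mul_first (U : lmodType k) : {linear tensor H (tensor H U) -> tensor H U} :=
  tlin (mul3_bilin U).

Lemma mul_firstE (U : lmodType k) h l (x : U) :
  mul_first U (h ⊗ (l ⊗ x)) = (h * l) ⊗ x.
Proof. by rewrite /mul_first tlinE tlinE. Qed.

Lemma comorph_mul_first (C : coalgType k) : comorph (mul_first C).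
Proof.
have ext2 (U : lmodType k) (f g : H -> tensor H C -> U) h :
    (forall h, linear (f h)) -> (forall h, linear (g h)) ->
    (forall h l x, f h (l ⊗ x) = g h (l ⊗ x)) -> f h =1 g h.
  by move=> Hf Hg fg; apply: tensor_ext.
apply: comorph_tensor => h t; move: h t.
  move=> h; apply: (ext2 k^o (fun h t => counit (mul_first C (h ⊗ t)))
    (fun h t => counit h * counit t)) => {h} [h|h|h l x].
  - by move=> c x y; rewrite !(pureE, linearP).
  - by move=> c x y; rewrite linearP mulrDr mulrCA.
  - by rewrite mul_firstE !counit_tensor counitM mulrA.
have HB (a b : H) : bilin (fun x y : tensor H C => mul_first C (a ⊗ x) ⊗ mul_first C (b ⊗ y)).
  by split=> ? ? ? ?; rewrite !(pureE, linearP).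
move=> h; apply: (ext2 _ (fun h t => comul (mul_first C (h ⊗ t)))
  (fun h t => \sum_(p <- sw h) \sum_(q <- sw t)
     mul_first C (p.1 ⊗ q.1) ⊗ mul_first C (p.2 ⊗ q.2))) => {h} [h|h|h l x].
- by move=> c x y; rewrite !(pureE, linearP).
- by apply: linear_sumr => p; exact: (sw_linear (HB _ _)).
- under [RHS]eq_bigr do rewrite (sw_tensor _ _ (HB _ _)).
  rewrite mul_firstE -[LHS]sw_pure (sw_tensor _ _ (bilin_pure _ _)).
  have HB2 : bilin (fun a b : H => \sum_(q <- sw x) (a ⊗ q.1) ⊗ (b ⊗ q.2)).
    by split=> ?; apply: linear_sumr => q ? ? ?; rewrite !pureE.
  rewrite (@swE _ H _ (fun a b => \sum_(q <- sw x) (a ⊗ q.1) ⊗ (b ⊗ q.2))) comulM (linear_sum' _ _ (tlift_linear HB2)).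
  apply: eq_bigr => p _; rewrite (linear_sum' _ _ (tlift_linear HB2)).
  apply: eq_bigr => q _; rewrite (tliftE _ _ HB2).
  by apply: eq_bigr => r _; rewrite !mul_firstE.
Qed.

Lemma drop1_bilin (U : lmodType k) : bilin (fun (h : H) (x : U) => counit h *: x).
Proof.
split=> [x|h] c u v; first by rewrite linearP scalerDl scalerA.
by rewrite scalerDr !scalerA mulrC.
Qed.

(* (h^1, ..., h^{n+1}) |-> ε(h^{n+1}) (h^1, ..., h^n) *)
Fixpoint drop_last (n : nat) : {linear tpow n.+1 -> tpow n} :=
  if n is m.+1 then tmap idfun (drop_last m) else tlin (drop1_bilin (tpow 0)).

(* (h^1, ..., h^{n+1}) |-> (h^1, ..., h^i h^{i+1}, ..., h^{n+1}), for 1 <= i <= n;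
   the values for other i are irrelevant. *)
Fixpoint merge (n i : nat) : {linear tpow n.+1 -> tpow n} :=
  if n is m.+1 then
    if i is j.+2 then tmap idfun (merge m j.+1) else mul_first (tpow m)
  else drop_last 0.

Lemma drop_lastS n h (x : tpow n.+1) : drop_last n.+1 (h ⊗ x) = h ⊗ drop_last n x.
Proof. exact: tlinE. Qed.

Lemma drop_last0 h (c : tpow 0) : drop_last 0 (h ⊗ c) = counit h *: c.
Proof. exact: tlinE. Qed.

Lemma merge1 n h l (x : tpow n) : merge n.+1 1 (h ⊗ (l ⊗ x)) = (h * l) ⊗ x.
Proof. exact: mul_firstE. Qed.

Lemma mergeS n i h (x : tpow n.+1) :
  merge n.+1 i.+2 (h ⊗ x) = h ⊗ merge n i.+1 x.
Proof. exact: tlinE. Qed.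

Lemma comorph_drop_last n : comorph (drop_last n).
Proof.
elim: n => [|n IHn]; last exact: (comorph_tmap (comorph_id H) IHn).
apply: comorph_tensor => h c.
  by rewrite tlinE linearZ.
rewrite tlinE linearZZ -(@sw_pure _ (tpow 0)).
transitivity (\sum_(p <- sw h) (counit p.1 * counit p.2) *:
    \sum_(q <- sw (c : tpow 0)) (q.1 ⊗ q.2 : tensor (tpow 0) (tpow 0))).
  rewrite -scaler_suml; congr (_ *: _); rewrite -[in LHS](counitl h) linear_sum.
  by apply: eq_bigr => p _; rewrite linearZ.
apply: eq_bigr => p _; rewrite scaler_sumr.
by apply: eq_bigr => q _; rewrite !tlinE !pureE scalerA.
Qed.

Lemma comorph_merge n i : comorph (merge n i).
Proof.
elim: n i => [|n IHn] i; first exact: (comorph_drop_last 0).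
case: i => [|[|i]]; [exact: comorph_mul_first|exact: comorph_mul_first|].
exact: (comorph_tmap (comorph_id H) (IHn _)).
Qed.

Lemma unit_linear (U : cocomCoalgType k) : linear (fun x : U => counit x *: (1 : H)).
Proof. by move=> c u v; rewrite linearP scalerDl scalerA. Qed.

Lemma mul_bilin (U : lmodType k) (f : {linear U -> H}) :
  bilin (fun (h : H) (x : U) => h * f x).
Proof.
split=> [x|h] c u v; first by rewrite mulrDl scalerAl.
by rewrite linearP mulrDr scalerAr.
Qed.

(* (h^1, ..., h^n) |-> h^1 ... h^l ε(h^{l+1}) ... ε(h^n) *)
Fixpoint prodl (l n : nat) {struct n} : {linear tpow n -> H} :=
  if n is m.+1 then
    if l is j.+1 then tlin (mul_bilin (prodl j m))
    else mklin (@unit_linear (tpow m.+1))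
  else mklin (@unit_linear (tpow 0)).

Lemma prodlS l n h x : prodl l.+1 n.+1 (h ⊗ x) = h * prodl l n x.
Proof. exact: tlinE. Qed.

Lemma prodl0 n x : prodl 0 n x = counit x *: (1 : H).
Proof. by case: n x. Qed.

Lemma comorph_unit (C : cocomCoalgType k) : comorph (mklin (@unit_linear C)).
Proof.
split=> x; rewrite mklinE; first by rewrite linearZ /= counit1 mulr1.
rewrite linearZZ comul1 -[in LHS](counitl x) linear_sum scaler_suml.
apply: eq_bigr => p _; rewrite !mklinE !pureE linearZ /= scalerA.
by rewrite mulrC.
Qed.

Lemma comorph_prodl l n : comorph (prodl l n).
Proof.
elim: n l => [|n IHn] [|l]; try exact: comorph_unit.
have [IHc IHM] := IHn l.
apply: comorph_tensor => h x; first by rewrite prodlS counitM IHc.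
rewrite prodlS comulM; apply: eq_bigr => p _.
rewrite (@comorph_sw _ _ _ _ _ (fun a b => (p.1 * a) ⊗ (p.2 * b)) _ (IHn l)).
  by apply: eq_bigr => q _; rewrite !prodlS.
by split=> a c x' y; rewrite mulrDr -scalerAr !pureE.
Qed.

Lemma prodl_merge n i l x : (0 < i <= n)%N ->
  prodl l n (merge n i x) = prodl (if (l < i)%N then l else l.+1) n.+1 x.
Proof.
elim: n i l x => [|n IHn] [|i] l x // lti.
case: l => [|l].
  by rewrite ltn0Sn !prodl0 (comorph_merge n.+1 i.+1).1.
move: x; apply: tensor_ext => [c x y|c x y|h x]; try by rewrite !linearP.
case: i lti => [_|i lti].
  move: x; apply: tensor_ext => [c x y|c x y|g x]; try by rewrite !(pureE, linearP).
  by rewrite mul_firstE !prodlS mulrA.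
rewrite [tmap _ _ _]tlinE prodlS IHn; last exact: lti.
by rewrite [in RHS]ltnS; case: ifP => _; rewrite prodlS.
Qed.

Lemma prodl_drop_last n l x : (l <= n)%N ->
  prodl l n (drop_last n x) = prodl l n.+1 x.
Proof.
elim: n l x => [|n IHn] [|l] x // ln.
  by rewrite !prodl0; congr (_ *: _); exact: (comorph_drop_last n.+1).1.
move: x; apply: tensor_ext => [c x y|c x y|h x]; try by rewrite !linearP.
by rewrite [drop_last _ _]tlinE !prodlS IHn.
Qed.

End TensorPower.

Section PartialCohomology.
Context {k : fieldType} {H : cocomHopfAlgType k} {A : comUnitalAlgType k}.
Variable act : partial_action H A.

Notation Hom n := (conv (tpow H n) A).

Lemma act_unit_linear : linear (fun h : H => act (h ⊗ aone)).
Proof. by move=> c x y; rewrite !pureE linearP. Qed.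

Definition act_unit : conv H A := mklin act_unit_linear.

Lemma act_unitE h : act_unit h = act (h ⊗ aone).
Proof. by []. Qed.

Definition etil (l n : nat) : Hom n := pull (prodl H l n) act_unit.

Definition eidem (n : nat) : Hom n := \prod_(1 <= l < n.+1) etil l n.

Definition in_ideal n (f : Hom n) : Prop := exists g : Hom n, f = eidem n * g.

Definition is_cochain n (f : Hom n) : Prop :=
  in_ideal f /\ exists2 g : Hom n, in_ideal g & f * g = eidem n.

(* Invertible elements of the ideal. For n = 0, [Hom 0] is Hom_k(k, A), that is A,
   and [eidem 0] is its unit. *)
Record cochain (n : nat) := Cochain {
  cochain_val :> Hom n;
  cochainP : is_cochain cochain_val
}.

Lemma act_unitM : act_unit * act_unit = act_unit.
Proof.
apply: conv_ext => h; rewrite convME -[RHS]/(act (h ⊗ aone)).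
by rewrite -[in RHS](amul1 aone) pactM.
Qed.

Lemma etilM l n : etil l n * etil l n = etil l n.
Proof. by rewrite -pullM ?act_unitM //; exact: comorph_prodl. Qed.

Lemma eidem_absorb l n : (0 < l <= n)%N -> eidem n * etil l n = eidem n.
Proof.
move=> ln; have lin : l \in index_iota 1 n.+1 by rewrite mem_index_iota ltnS.
rewrite /eidem (bigD1_seq l lin (iota_uniq _ _)) /=.
by rewrite mulrC mulrA etilM.
Qed.

Lemma absorb_prod n (e : Hom n) I (r : seq I) (P : pred I) (F : I -> Hom n) :
  (forall i, P i -> e * F i = e) -> e * \prod_(i <- r | P i) F i = e.
Proof.
move=> HF; elim/big_rec: _ => [|i x Pi ex]; first by rewrite mulr1.
by rewrite mulrA HF.
Qed.

Lemma eidemM n : eidem n * eidem n = eidem n.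
Proof.
rewrite {2}/eidem big_nat; apply: absorb_prod => l.
by rewrite ltnS; exact: eidem_absorb.
Qed.

Lemma cochain_ext n (f g : cochain n) : f = g :> Hom n -> f = g.
Proof.
by case: f g => [f fP] [g gP] /= fg; subst g; rewrite (Prop_irrelevance fP gP).
Qed.

Lemma cinv_subproof n (f : cochain n) :
  exists g : Hom n, is_cochain g /\ (f : Hom n) * g = eidem n.
Proof.
case: f => f [fI [g gI fg]]; exists g; split=> //; split=> //.
by exists f => //=; rewrite mulrC.
Qed.

Definition cinv n (f : cochain n) : cochain n :=
  Cochain (proj1 (svalP (cid (cinv_subproof f)))).

Lemma mulcV n (f : cochain n) : (f : Hom n) * cinv f = eidem n.
Proof. exact: (proj2 (svalP (cid (cinv_subproof f)))). Qed.

Lemma cinv_uniq n (f : cochain n) (g : Hom n) :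
  in_ideal g -> (f : Hom n) * g = eidem n -> g = cinv f.
Proof.
have E (u : Hom n) : in_ideal u -> eidem n * u = u.
  by move=> [v ->]; rewrite mulrA eidemM.
move=> gI fg; have [cI _] := cochainP (cinv f).
by rewrite -(E g gI) -(mulcV f) mulrAC fg E.
Qed.

(* h ⊗ x |-> h · f(x) *)
Definition act_first n (f : Hom n) : Hom n.+1 :=
  (act : {linear tensor H A -> A}) \o tmap idfun (f : {linear tpow H n -> A})
    : {linear tpow H n.+1 -> A}.

Definition merge_at n (i : nat) (f : Hom n) : Hom n.+1 :=
  @pull k A (tpow H n) (tpow H n.+1) (merge H n i) f.

Definition forget_last n (f : Hom n) : Hom n.+1 :=
  @pull k A (tpow H n) (tpow H n.+1) (drop_last H n) f.

(* f^((-1)^i) *)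
Definition csign n (f : cochain n) (i : nat) : cochain n :=
  if odd i then cinv f else f.

(* The Sweedler formula for the coboundary, read as the convolution product in
   Hom_k(H^{⊗ n+1}, A) of its n + 2 factors. *)
Definition delta_fun n (f : cochain n) : Hom n.+1 :=
  act_first f
  * \prod_(1 <= i < n.+1) merge_at i (csign f i)
  * forget_last (csign f n.+1).

Lemma act_firstE n (f : Hom n) h (x : tpow H n) :
  act_first f (h ⊗ x) = act (h ⊗ f x).
Proof. by rewrite -[LHS]/(act (tmap idfun (f : {linear tpow H n -> A}) (h ⊗ x))) tlinE. Qed.

Lemma act_firstM n (f g : Hom n) : act_first (f * g) = act_first f * act_first g.
Proof.
apply: conv_ext; apply: tensor_ext => [||h x]; try exact: linearP.
rewrite act_firstE !convME.
rewrite (sw_tensor _ _ (conv_bilin (act_first f) (act_first g))).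
rewrite (linear_sum' _ _ ((bilin_pure H A).2 h)) linear_sum exchange_big.
by apply: eq_bigr => q _; rewrite pactM; under [RHS]eq_bigr do rewrite !act_firstE.
Qed.

Lemma act_first_etil l n :
  act_first (etil l n) = etil 1 n.+1 * etil l.+1 n.+1.
Proof.
apply: conv_ext; apply: tensor_ext => [||h x]; try exact: linearP.
rewrite act_firstE convME (sw_tensor _ _ (conv_bilin (etil 1 n.+1) (etil l.+1 n.+1))).
rewrite pullE -[act_unit _]/(act (_ ⊗ _)) pact_act; apply: eq_bigr => p _.
rewrite -[in LHS](counitl x) linear_sum mulr_sumr.
rewrite (linear_sum' _ _ ((bilin_pure H A).1 _)) linear_sum amul_sumr.
apply: eq_bigr => q _; rewrite linearZZ -scalerAr pureZl linearZZ amulzr.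
rewrite !pullE !prodlS prodl0 -scalerAr mulr1.
by rewrite -![act_unit _]/(act (_ ⊗ _)) pureZl linearZZ amulzl.
Qed.

Lemma act_first1 n : act_first (1 : Hom n) = etil 1 n.+1.
Proof.
apply: conv_ext; apply: tensor_ext => [||h x]; try exact: linearP.
rewrite act_firstE conv1E pureZr linearZZ pullE prodlS prodl0 -scalerAr mulr1.
by rewrite linearZZ.
Qed.

Lemma act_first_eidem n : act_first (eidem n) = eidem n.+1.
Proof.
have H1 (r : seq nat) : act_first (\prod_(l <- r) etil l n) =
    etil 1 n.+1 * \prod_(l <- r) etil l.+1 n.+1.
  elim: r => [|l r IHr]; first by rewrite !big_nil act_first1 mulr1.
  rewrite !big_cons act_firstM IHr act_first_etil.
  by rewrite mulrACA etilM.
by rewrite /eidem H1 [RHS]big_nat_recl // [in RHS]big_add1.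
Qed.

Lemma merge_atM n i (f g : Hom n) : merge_at i (f * g) = merge_at i f * merge_at i g.
Proof. exact/pullM/comorph_merge. Qed.

Lemma forget_lastM n (f g : Hom n) : forget_last (f * g) = forget_last f * forget_last g.
Proof. exact/pullM/comorph_drop_last. Qed.

Lemma pull_merge_etil n i l : (0 < i <= n)%N ->
  merge_at i (etil l n) = etil (if (l < i)%N then l else l.+1) n.+1.
Proof.
by move=> lti; apply: conv_ext => x; rewrite /merge_at !pullE prodl_merge.
Qed.

Lemma pull_drop_last_etil n l : (l <= n)%N ->
  forget_last (etil l n) = etil l n.+1.
Proof. by move=> ln; apply: conv_ext => x; rewrite /forget_last !pullE prodl_drop_last. Qed.

Lemma eidem_pull_merge n i : (0 < i <= n)%N ->
  eidem n.+1 * merge_at i (eidem n) = eidem n.+1.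
Proof.
move=> lti; rewrite /merge_at (pull_prod _ _ (comorph_merge H n i)) big_nat.
apply: absorb_prod => l; rewrite ltnS => /andP[l0 ln].
rewrite -/(merge_at i _) pull_merge_etil //; apply: eidem_absorb.
by case: ifP => _ //; rewrite l0 (leq_trans ln).
Qed.

Lemma eidem_pull_drop_last n :
  eidem n.+1 * forget_last (eidem n) = eidem n.+1.
Proof.
rewrite /forget_last (pull_prod _ _ (comorph_drop_last H n)) big_nat.
apply: absorb_prod => l; rewrite ltnS => /andP[l0 ln].
by rewrite -/(forget_last _) pull_drop_last_etil //; apply: eidem_absorb; rewrite l0 ltnW.
Qed.

Lemma mulVc n (f : cochain n) : (cinv f : Hom n) * f = eidem n.
Proof. by rewrite mulrC mulcV. Qed.

Lemma cochain_eidem n (f : cochain n) : eidem n * (f : Hom n) = f :> Hom n.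
Proof. by case: (cochainP f) => -[g ->] _; rewrite mulrA eidemM. Qed.

Lemma csign_cinv n (f : cochain n) i : (csign f i : Hom n) * csign (cinv f) i = eidem n.
Proof. by rewrite /csign; case: odd; rewrite mulcV. Qed.

Lemma delta_fun_ideal n (f : cochain n) : in_ideal (delta_fun f).
Proof.
exists (delta_fun f); rewrite /delta_fun -{1}(cochain_eidem f) act_firstM.
by rewrite act_first_eidem !mulrA.
Qed.

Lemma delta_funV n (f : cochain n) : delta_fun f * delta_fun (cinv f) = eidem n.+1.
Proof.
rewrite /delta_fun mulrACA -forget_lastM csign_cinv.
rewrite mulrACA -act_firstM mulcV act_first_eidem -big_split /=.
rewrite -mulrA [X in _ * X]mulrC mulrA eidem_pull_drop_last big_nat.
apply: (@absorb_prod _ _ _ _ _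
  (fun i => merge_at i (csign f i) * merge_at i (csign (cinv f) i))) => i.
rewrite ltnS => lti.
by rewrite -merge_atM csign_cinv eidem_pull_merge.
Qed.

Lemma delta_funP n (f : cochain n) : is_cochain (delta_fun f).
Proof.
split; first exact: delta_fun_ideal.
by exists (delta_fun (cinv f)); [exact: delta_fun_ideal|exact: delta_funV].
Qed.

Definition delta n (f : cochain n) : cochain n.+1 := Cochain (delta_funP f).

(* In degree 0, with a = f(1): (δ a)(h) = (h · a) a^{-1} *)
Lemma delta0E (f : cochain 0) (h : H) :
  delta f (h ⊗ (1 : tpow H 0)) =
  act (h ⊗ f (1 : tpow H 0)) ∙ cinv f (1 : tpow H 0).
Proof.
rewrite -[LHS]/(delta_fun f _) /delta_fun big_geq // mulr1 convME.
rewrite (sw_tensor _ _ (conv_bilin (act_first f) (forget_last (csign f 1)))).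
rewrite -[in RHS](counitr h) (linear_sum' _ _ ((bilin_pure H A).1 _)) linear_sum.
rewrite amul_suml; apply: eq_bigr => p _.
rewrite (@sw_ground _ _ (fun a b : tpow H 0 =>
  act_first f (p.1 ⊗ a) ∙ forget_last (csign f 1) (p.2 ⊗ b))); last first.
  by split=> ? ? ? ?; rewrite !pureE linearP !amulE.
rewrite scale1r act_firstE pureZl linearZZ amulzl -amulzr; congr (_ ∙ _).
by rewrite /forget_last pullE [drop_last _ _ _]tlinE linearZZ.
Qed.

End PartialCohomology.

(* Main.v *)
Require Import Defs.
From mathcomp Require Import all_boot all_order all_algebra.

(** The coboundary is the alternating convolution product of coface maps
    [d_0, ..., d_{n+1}] from Hom(H^{⊗ n}, A) to Hom(H^{⊗ n+1}, A): [d_0] lets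
    the first argument act, [d_i] multiplies two neighbouring arguments, and
    [d_{n+1}] drops the last one.  Each [d_i] is multiplicative, so the double
    coboundary is the product over [j] and [i] of the terms
    [d_j (d_i f^(-1)^(i+j))].

    For a global action the cosimplicial identities [d_j d_i = d_i d_{j-1}],
    [i < j], cancel these terms in pairs.  For a partial action all of them
    survive (they express associativity in [H] and multiplicativity of the
    counit) except [d_1 d_0 = d_0 d_0], which by (PA3) only holds up to the
    factor [h^1 · 1_A] ([act_first_act_first]).  That factor divides the
    idempotent [e_{n+2}], so all the identities hold after multiplication by
    [e_{n+2}] ([eidem_face_face]).  As the double coboundary lies in the ideal
    generated by [e_{n+2}], it may be multiplied by this idempotent at no cost,
    and each cancelling pair then contributes [e_{n+2} * d_i (d_{j-1} e_n)],
    that is [e_{n+2}] ([eidem_face_face_eidem]).  The bookkeeping of the pairs is the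
    purely ring-theoretic lemma [prod_cosimplicial_pairs]. *)

Set Implicit Arguments.
Unset Strict Implicit.
Unset Printing Implicit Defensive.

Import GRing.Theory.
Local Open Scope ring_scope.

(** The index set {0..m} x {0..m-1} is matched by (b+1, a) <-> (a, b) for
    a <= b, as in the proof that the square of an alternating sum of cofaces
    vanishes.  Passing from m to m+1 adds one row and one column, which the
    matching exchanges. *)
Lemma prod_cosimplicial_pairs (R : comPzRingType) (e : R) (G : nat -> nat -> R) m :
  (forall a b, (a <= b < m)%N -> e * (G b.+1 a * G a b) = e) ->
  e * \prod_(0 <= j < m.+1) \prod_(0 <= i < m) G j i = e.
Proof.
elim: m => [|m IHm] HG.
  by rewrite big_nat1 big_geq // mulr1.
rewrite big_nat_recr //=.
under eq_bigr do rewrite big_nat_recr //=.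
rewrite big_split /= -mulrA -big_split /= mulrA IHm.
  rewrite big_nat; elim/big_rec: _ => [|a x /andP[_ am] ex]; first by rewrite mulr1.
  by rewrite mulrA [G a m * _]mulrC HG // -ltnS am ltnSn.
by move=> a b /andP[ab bm]; apply: HG; rewrite ab ltnW.
Qed.

Section Cofaces.
Context {k : fieldType} {H : cocomHopfAlgType k} {A : comUnitalAlgType k}.
Variable act : partial_action H A.

Notation Hom n := (conv (tpow H n) A).

(** Out of its intended range, at i = n+1, [merge] drops the last tensorand;
    this puts the last coface on the same footing as the inner ones. *)
Lemma merge_last n : Defs.merge H n n.+1 = drop_last H n.
Proof. by elim: n => //= n ->. Qed.

(** The inner and last cofaces come from maps of tensor powers, so for them the
    cosimplicial identities hold exactly.  Their only content is the case
    j = i+1, where they are associativity in [H], or [counitM] when j is the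
    last index. *)
Lemma merge_merge n i j (x : tpow H n.+2) : (0 < i < j)%N -> (j <= n.+2)%N ->
  Defs.merge H n i (Defs.merge H n.+1 j x) = Defs.merge H n j.-1 (Defs.merge H n.+1 i x).
Proof.
elim: n i j x => [|n IHn] [|i] [|[|j]] x // ij jn.
  (* i = 1 and j = 2 in degree 0: both sides drop everything, by ε(hl) = ε(h)ε(l). *)
  move: i j ij jn => [|i] [|j] // _ _; move: x.
  apply: tensor_ext => [c x y|c x y|h x]; try by rewrite !linearP.
  move: x; apply: tensor_ext => [c x y|c x y|l x]; try by rewrite !(pureE, linearP).
  rewrite mergeS merge1 -[Defs.merge H 0 _]/(drop_last H 0).
  by rewrite 3!(@drop_last0 _ H) counitM scalerA.
move: x; apply: tensor_ext => [c x y|c x y|h x]; try by rewrite !linearP.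
case: i ij => [|i] ij; last first.
  case: j ij jn => // j ij jn.
  by rewrite !mergeS IHn.
move: x; apply: tensor_ext => [c x y|c x y|l x]; try by rewrite !(pureE, linearP).
case: j ij jn => [|j] _ jn; last by rewrite !mergeS !merge1 mergeS.
move: x; apply: tensor_ext => [c x y|c x y|m x]; try by rewrite !(pureE, linearP).
by rewrite mergeS !merge1 mulrA.
Qed.

Definition face n (i : nat) (f : Hom n) : Hom n.+1 :=
  if i is 0 then act_first act f else merge_at i f.

Lemma faceM n i (f g : Hom n) : face i (f * g) = face i f * face i g.
Proof. by case: i => [|i]; [exact: act_firstM|exact: merge_atM]. Qed.

Lemma delta_fun_face n (f : cochain act n) :
  delta_fun f = \prod_(0 <= i < n.+2) face i (csign f i).
Proof.
rewrite big_nat_recl // big_nat_recr //= mulrA /delta_fun big_add1 /=.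
by rewrite /forget_last /merge_at merge_last.
Qed.

(** [d_0] does not preserve the unit, so only nonempty products are
    preserved. *)
Lemma face_prod n j m (F : nat -> Hom n) :
  face j (\prod_(0 <= i < m.+1) F i) = \prod_(0 <= i < m.+1) face j (F i).
Proof.
elim: m => [|m IHm]; first by rewrite !big_nat1.
by rewrite big_nat_recr // [RHS]big_nat_recr //= faceM IHm.
Qed.

Lemma eidem_face n i : (i <= n.+1)%N ->
  eidem act n.+1 * face i (eidem act n) = eidem act n.+1.
Proof.
case: i => [|i] lein; first by rewrite /face act_first_eidem eidemM.
move: lein; rewrite leq_eqVlt => /orP[/eqP[->]|ltin]; last exact: eidem_pull_merge.
by rewrite /face /merge_at merge_last; exact: eidem_pull_drop_last.
Qed.

(** This is (PA3): the cosimplicial identity [d_0 d_0 = d_1 d_0] up to the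
    factor [h^1 · 1_A]. *)
Lemma act_first_act_first n (f : Hom n) :
  act_first act (act_first act f) =
  etil act 1 n.+2 * merge_at 1 (act_first act f).
Proof.
apply: conv_ext; apply: tensor_ext => [||h y]; try exact: linearP.
move: y; apply: tensor_ext => [c x y|c x y|l x]; try by rewrite !(pureE, linearP).
rewrite act_firstE [act_first act f _]act_firstE pact_act convME.
rewrite (sw_tensor _ _ (conv_bilin (etil act 1 n.+2) (merge_at 1 (act_first act f)))).
apply: eq_bigr => p _.
(* The counit expands l ⊗ x into the Sweedler sum over which the convolution
   on the right runs; its first leg meets only ε. *)
rewrite -(act_firstE act f) -merge1 -[in LHS](counitl (l ⊗ x : tpow H n.+1)).
rewrite (linear_sum' _ _ ((bilin_pure H _).2 _)).
rewrite (linear_sum (Defs.merge H n.+1 1)) (linear_sum (act_first act f)) amul_sumr.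
apply: eq_bigr => q _.
rewrite pureZr !linearZZ amulzr -amulzl; congr (_ ∙ _).
by rewrite pullE prodlS prodl0 -scalerAr mulr1 -[RHS]/(act _) pureZl linearZZ.
Qed.

(** Outside the case i = 0, j = 1 the identity holds already without the
    idempotent. *)
Lemma eidem_face_face n i j (f : Hom n) : (i < j <= n.+2)%N ->
  eidem act n.+2 * face j (face i f) = eidem act n.+2 * face i (face j.-1 f).
Proof.
case: j => [|j] // /andP[ij jn]; case: i ij => [|i] ij.
  case: j ij jn => [|j] _ jn.
    by rewrite /face act_first_act_first mulrA eidem_absorb.
  congr (_ * _); apply: conv_ext; apply: tensor_ext => [||h x]; try exact: linearP.
  by rewrite act_firstE [LHS]pullE mergeS act_firstE.
case: j ij jn => // j ij jn; congr (_ * _); apply: conv_ext => x.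
by rewrite ![face _ _ _]pullE merge_merge.
Qed.

Lemma eidem_face_face_eidem n i j : (i <= n.+1)%N -> (j <= n.+2)%N ->
  eidem act n.+2 * face j (face i (eidem act n)) = eidem act n.+2.
Proof.
by move=> lein lejn; rewrite -{1}(eidem_face lejn) -mulrA -faceM !eidem_face.
Qed.

Lemma csign_delta n (f : cochain act n) j :
  csign (delta f) j = delta (csign f j).
Proof.
rewrite /csign; case: odd => //; apply: cochain_ext; apply/esym/cinv_uniq.
  exact: delta_fun_ideal.
exact: delta_funV.
Qed.

(** The exponents of the two terms of a cancelling pair, [(-1)^(b+1+a)] and
    [(-1)^(a+b)], are opposite. *)
Lemma csign_pair n (f : cochain act n) a b :
  (csign (csign f b.+1) a : Hom n) * csign (csign f a) b = eidem act n.
Proof. by rewrite /csign /=; case: (odd a); case: (odd b); rewrite ?mulcV ?mulVc. Qed.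

End Cofaces.

Theorem theorem3p11 (k : fieldType) (H : cocomHopfAlgType k)
    (A : comUnitalAlgType k) (act : partial_action H A)
    (n : nat) (f : cochain act n) :
  cochain_val (delta (delta f)) = eidem act n.+2.
Proof.
rewrite -(cochain_eidem (delta (delta f))).
rewrite -[cochain_val _]/(delta_fun (delta f)) delta_fun_face.
under eq_bigr => j _ do
  rewrite csign_delta -[cochain_val _]/(delta_fun _) delta_fun_face face_prod.
apply: prod_cosimplicial_pairs => a b /andP[ab bn].
have ba : (a < b.+1 <= n.+2)%N by rewrite ltnS ab.
rewrite mulrA (eidem_face_face _ _ ba) -mulrA -!faceM csign_pair.
by rewrite eidem_face_face_eidem // (leq_trans ab) // ltnW.
Qed.
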